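(* Let $\Pi=(X,U,F,G,g)$ be an optimal control problem with value function $V$ such that $X$ is a proper metric space, $U$ is a compact metric space, $F$ is compact-valued, and $g$, $G$ and $F$ are upper semi-continuous. For every $i\in\mathbb{N}$, let $\Pi_i=(X_i,U_i,F_i,G_i,g_i)$ be an abstraction of conservatism $\rho_i\in\mathbb{R}_+\cup\{\infty\}$ of $\Pi$, let $C_i$ be an optimal controller for $\Pi_i$, and let $L_i$ be the closed-loop value function of $\Pi$ associated with $C_i\circ\mathop{\in}$, where $\mathop{\in}\colon X\rightrightarrows X_i$ is the membership relation. Suppose $\lim_{i\to\infty}\rho_i=0$. Then $$V(p)=\lim_{i\to\infty}L_i(p)\quad\text{for all }p\in X,$$ and the following holds for every compact subset $N\subseteq X$. (i) For every $\varepsilon>0$ and all sufficiently large $i\in\mathbb{N}$ we have $\sup L_i(N)\le\varepsilon+\sup V(N)$. (ii) If $V$ is real-valued on $N$, then $\sup V(N)<\infty$, and if $V$ is additionally continuous on $N$, then the convergence $L_i(p)\to V(p)$ is uniform with respect to $p\in N$.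
   Context: Conventions: $\mathbb{R}_+=[0,\infty)$, $\mathbb{Z}_+=\{0,1,2,\dots\}$, $\mathbb{N}=\{1,2,\dots\}$; $\infty+x=\infty$ for $x\in\mathbb{R}$; $\sup\emptyset=0$; $A^B$ is the set of maps $B\to A$; limits of function values are in $[0,\infty]$. A set-valued map $f\colon A\rightrightarrows B$ assigns to each $a\in A$ a subset $f(a)\subseteq B$ and is identified with the relation $\{(a,b): b\in f(a)\}$; it is strict if $f(a)\neq\emptyset$ for all $a$. Images of sets are written $f(C)=\bigcup_{a\in C}f(a)$, and similarly for several arguments, e.g. $F_1(\Omega,u)=\bigcup_{p\in\Omega}F_1(p,u)$, $g_1(\Omega,\Omega',u)=\{g_1(p,p',u):p\in\Omega,p'\in\Omega'\}$. In a metric space $(X,d)$, $\bar B(c,r)$ is the closed ball, with $\bar B(c,0)=\{c\}$; for a set $M$, $\bar B(M,r)=\bigcup_{c\in M}\bar B(c,r)$; $d(M,N)=\inf\{d(x,y):x\in M,y\in N\}$; $\operatorname{diam}$ is the diameter. A metric space is proper if every closed ball is compact. A function $f\colon X\to[-\infty,\infty]$ on a metric space is upper semi-continuous if $\{(x,\gamma)\in X\times\mathbb{R}:\gamma\le f(x)\}$ is closed; a set-valued $f\colon A\rightrightarrows B$ between metric spaces is upper semi-continuous if $\{a: f(a)\cap\Omega\neq\emptyset\}$ is closed for every closed $\Omega\subseteq B$. System: a triple $(X,U,F)$ with nonempty sets $X,U$ and strict $F\colon X\times U\rightrightarrows X$. A pair $(u,x)\in U^{\mathbb{Z}_+}\times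 X^{\mathbb{Z}_+}$ is a solution of it if $x(t+1)\in F(x(t),u(t))$ for all $t\in\mathbb{Z}_+$. Controller for $(X,U,F)$: a quintuple $C=(Z,Z_0,\widetilde X,\widetilde U,H)$ of nonempty sets $Z,Z_0,\widetilde X,\widetilde U$ with $Z_0\subseteq Z$, $X\subseteq\widetilde X$, $\widetilde U\subseteq U$, and a strict map $H\colon Z\times\widetilde X\rightrightarrows Z\times\widetilde U\times\{0,1\}$. A quadruple $(u,v,z,x)\in\widetilde U^{\mathbb{Z}_+}\times\{0,1\}^{\mathbb{Z}_+}\times Z^{\mathbb{Z}_+}\times\widetilde X^{\mathbb{Z}_+}$ is a solution of $C$ if $z(0)\in Z_0$ and $(z(t+1),u(t),v(t))\in H(z(t),x(t))$ for all $t\in\mathbb{Z}_+$. $\mathcal{F}(X,U)$ denotes the collection of all controllers for $(X,U,F)$. Behavior: for a system $S=(X,U,F)$ and $C\in\mathcal{F}(X,U)$, $\mathcal{B}(C\times S)$ is the set of $(u,v,x)\in(U\times\{0,1\}\times X)^{\mathbb{Z}_+}$ for which there is $z\colon\mathbb{Z}_+\to Z$ such that $(u,v,z,x)$ is a solution of $C$ and $(u,x)$ is a solution of $S$; $\mathcal{B}_p(C\times S)=\{(u,v,x)\in\mathcal{B}(C\times S): x(0)=p\}$. Optimal control problem: a tuple $(X,U,F,G,g)$ where $(X,U,F)$ is a system, $G\colon X\to\mathbb{R}_+\cup\{\infty\}$ (terminal cost) and $g\colon X\times X\times U\to\mathbb{R}_+\cup\{\infty\}$ (running cost). Its cost functional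 $J\colon(U\times\{0,1\}\times X)^{\mathbb{Z}_+}\to[0,\infty]$ is $J(u,v,x)=G(x(T))+\sum_{t=0}^{T-1}g(x(t),x(t+1),u(t))$ if $v\neq0$, where $T=\min v^{-1}(1)$, and $J(u,v,x)=\infty$ if $v=0$. With $S=(X,U,F)$, the closed-loop value function associated with $C\in\mathcal{F}(X,U)$ is $L(p)=\sup_{(u,v,x)\in\mathcal{B}_p(C\times S)}J(u,v,x)$, and the value function is $V(p)=\inf_{C\in\mathcal{F}(X,U)}\sup_{(u,v,x)\in\mathcal{B}_p(C\times S)}J(u,v,x)$. A controller $C\in\mathcal{F}(X,U)$ is optimal for the problem if the closed-loop value function associated with $C$ coincides with the value function. Serial composition: for a controller $C=(Z,Z_0,\widetilde X,\widetilde U,H)$, a nonempty set $X'$ and a strict map $Q\colon X'\rightrightarrows\widetilde X$, $C\circ Q$ is the controller $(Z,Z_0,X',\widetilde U,H')$ with $H'(z,x')=\bigcup_{y\in Q(x')}H(z,y)$. Abstraction: let $\Pi_i=(X_i,U_i,F_i,G_i,g_i)$, $i=1,2$, be optimal control problems, where $X_2$ is a cover of $X_1$ (a set of subsets of $X_1$ with union $X_1$) by non-empty subsets. $\Pi_2$ is an abstraction of $\Pi_1$ if the membership relation $Q=\mathop{\in}\colon X_1\rightrightarrows X_2$, $\mathop{\in}(p)=\{\Omega\in X_2:p\in\Omega\}$, is a valuated feedback refinement relation from $\Pi_1$ to $\Pi_2$, i.e. $Q$ is strict and for all $(p_1,p_2),(q_1,q_2)\in Q$ and $u\in U_2$: $U_2\subseteq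 U_1$; $G_1(p_1)\le G_2(p_2)$; $g_1(p_1,q_1,u)\le g_2(p_2,q_2,u)$; $Q(F_1(p_1,u))\subseteq F_2(p_2,u)$. Conservatism: let $\Pi_2$ be an abstraction of $\Pi_1$, let $U_1,X_1$ be metric spaces ($d$ the metric on $X_1$), and let the elements of $X_2$ be closed subsets of $X_1$. Then $\Pi_2$ is an abstraction of conservatism $\infty$ of $\Pi_1$. It is an abstraction of conservatism $\rho\in\mathbb{R}_+$ of $\Pi_1$ if for all $\Omega,\Omega'\in X_2$ and $u\in U_2$: (i) $U_1=\bar B(U_2,\rho)$; (ii) $G_2(\Omega)\le\rho+\sup G_1(\Omega)$; (iii) $g_2(\Omega,\Omega',u)\le\rho+\sup g_1(\Omega,\Omega',u)$; and, if $\Omega$ satisfies $G_1(\Omega)\cup g_1(\Omega,X_1,U_1)\neq\{\infty\}$, additionally (iv) $F_2(\Omega,u)\subseteq\{\Omega''\in X_2: d(\Omega'',F_1(\Omega,u))\le\rho\}$; (v) $\operatorname{diam}(\Omega)\le\rho$. *)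

(* Defs.v *)
From mathcomp Require Import all_boot all_order all_algebra.
From mathcomp Require Import all_classical all_reals all_analysis.

Set Implicit Arguments.
Unset Strict Implicit.
Unset Printing Implicit Defensive.

Import Order.TTheory GRing.Theory Num.Theory.
Import numFieldNormedType.Exports.

Local Open Scope classical_set_scope.
Local Open Scope ring_scope.
Local Open Scope ereal_scope.

(* Subsets [A : set T] are used as types through the coercion [set_type] of
   classical_sets, whose injection into T is [val].  A relation (set-valued
   map) from A to B is a function [A -> set B]. *)

Definition strict (A B : Type) (f : A -> set B) : Prop :=
  forall a, f a !=set0.

(* The default value of [supremum] makes the supremum of the empty set 0
   (whereas [ereal_sup set0 = -oo]). *)
Definition esup0 (R : realType) (A : set (\bar R)) : \bar R := supremum 0 A.

Section Metric.
Context {R : realType} {X : metricType R}.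

(* The library's [closed_ball] is the closure of the open ball, which may be
   smaller. *)
Definition cball (c : X) (r : R) : set X := [set y | (mdist c y <= r)%R].

Definition cball_set (M : set X) (r : R) : set X := \bigcup_(c in M) cball c r.

Definition set_dist (M N : set X) : \bar R :=
  ereal_inf [set (mdist x y)%:E | x in M & y in N].

Definition diam (M : set X) : \bar R :=
  esup0 [set (mdist x y)%:E | x in M & y in M].

End Metric.

Definition proper_space (R : realType) (X : metricType R) : Prop :=
  forall (c : X) (r : R), (0 <= r)%R -> compact (cball c r).

Definition usc (R : realType) (T : topologicalType) (f : T -> \bar R) : Prop :=
  closed [set y : T * R | y.2%:E <= f y.1].

Definition usc_map (A B : topologicalType) (f : A -> set B) : Prop :=
  forall W : set B, closed W -> closed [set a | f a `&` W !=set0].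

Record system (X U : Type) := System {
  trans :> X -> U -> set X ;
  state_neq0 : [set: X] !=set0 ;
  input_neq0 : [set: U] !=set0 ;
  trans_neq0 : forall x u, trans x u !=set0 }.

Definition system_solution (X U : Type) (S : system X U)
    (u : nat -> U) (x : nat -> X) : Prop :=
  forall t, S (x t) (u t) (x t.+1).

(* The data of a controller for systems with states in X and inputs in U.  The
   measurement space [cX] is a superset of X, given as an arbitrary type
   together with an embedding [cin] of X; {0, 1} is [bool].  The requirements
   on these data are in [is_controller]. *)
Record controller (X U : Type) := Controller {
  cZ : Type ;
  cZ0 : set cZ ;
  cX : Type ;
  cin : X -> cX ;
  cU : set U ;
  cH : cZ -> cX -> set (cZ * U * bool) }.
Arguments cZ {X U} c.
Arguments cZ0 {X U} c.
Arguments cX {X U} c.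
Arguments cin {X U} c x.
Arguments cU {X U} c.
Arguments cH {X U} c z y.

(* Nonemptiness of [cZ] follows from that of [cZ0], and nonemptiness of [cX]
   from that of X. *)
Definition is_controller (X U : Type) (C : controller X U) : Prop :=
  [/\ cZ0 C !=set0, injective (cin C), cU C !=set0,
      (forall z y, cH C z y !=set0) &
      forall z y w, cH C z y w -> cU C w.1.2].

Definition controller_solution (X U : Type) (C : controller X U)
    (u : nat -> U) (v : nat -> bool) (z : nat -> cZ C)
    (y : nat -> cX C) : Prop :=
  [/\ (forall t, cU C (u t)), cZ0 C (z 0%N) &
      forall t, cH C (z t) (y t) (z t.+1, u t, v t)].

Arguments controller_solution {X U} C u v z y.

Definition behavior (X U : Type) (C : controller X U) (S : system X U)
    (u : nat -> U) (v : nat -> bool) (x : nat -> X) : Prop :=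
  (exists z : nat -> cZ C, controller_solution C u v z (fun t => cin C (x t))) /\
  system_solution S u x.

Record ocp (R : realType) (X U : Type) := OCP {
  osys :> system X U ;
  tcost : X -> \bar R ;
  rcost : X -> X -> U -> \bar R ;
  tcost_ge0 : forall x, 0 <= tcost x ;
  rcost_ge0 : forall x y u, 0 <= rcost x y u }.

Definition cost (R : realType) (X U : Type) (P : ocp R X U)
    (u : nat -> U) (v : nat -> bool) (x : nat -> X) : \bar R :=
  if pselect (exists t, v t) is left vt then
    let T := ex_minn vt in
    tcost P (x T) + \sum_(0 <= t < T) rcost P (x t) (x t.+1) (u t)
  else +oo.

Definition closed_loop_value (R : realType) (X U : Type) (P : ocp R X U)
    (C : controller X U) (p : X) : \bar R :=
  esup0 [set j | exists u v x,
    [/\ behavior C P u v x, x 0%N = p & j = cost P u v x]].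

Definition value (R : realType) (X U : Type) (P : ocp R X U) (p : X) : \bar R :=
  ereal_inf [set l | exists C : controller X U,
    is_controller C /\ l = closed_loop_value P C p].

Definition optimal (R : realType) (X U : Type) (P : ocp R X U)
    (C : controller X U) : Prop :=
  is_controller C /\ forall p, closed_loop_value P C p = value P p.

Definition serial (X X' U : Type) (C : controller X U) (Q : X' -> set (cX C)) :
    controller X' U :=
  @Controller X' U (cZ C) (cZ0 C) X' id (cU C)
    (fun z x' => \bigcup_(y in Q x') cH C z y).

(* A controller whose inputs lie in U2, regarded as one with inputs in the
   larger set U1. *)
Definition widen_inputs (X U1 : Type) (U2 : set U1) (C : controller X U2) :
    controller X U1 :=
  @Controller X U1 (cZ C) (cZ0 C) (cX C) (cin C) (val @` cU C)
    (fun z y => [set (w.1.1, val w.1.2, w.2) | w in cH C z y]).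

Definition member (X1 : Type) (X2 : set (set X1)) (p : X1) : set X2 :=
  [set W | val W p].
Arguments member {X1} X2 p.

(* The composition of C with the membership relation from X1 to X2, the latter
   being a subset of the measurement space of C. *)
Definition serial_member (X1 U1 : Type) (X2 : set (set X1)) (U2 : set U1)
    (C : controller X2 U2) : controller X1 U1 :=
  widen_inputs (serial (fun p => cin C @` member X2 p)).

(* Valuated feedback refinement relation; the condition that the inputs of the
   second problem be inputs of the first is built into the type of P2. *)
Definition vfrr (R : realType) (X1 X2 U1 : Type) (U2 : set U1)
    (P1 : ocp R X1 U1) (P2 : ocp R X2 U2) (Q : X1 -> set X2) : Prop :=
  strict Q /\
  forall p1 p2 q1 q2 (u : U2), Q p1 p2 -> Q q1 q2 ->
    [/\ tcost P1 p1 <= tcost P2 p2,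
        rcost P1 p1 q1 (val u) <= rcost P2 p2 q2 u &
        \bigcup_(y in P1 p1 (val u)) Q y `<=` P2 p2 u].

Definition abstraction (R : realType) (X1 U1 : Type)
    (X2 : set (set X1)) (U2 : set U1)
    (P1 : ocp R X1 U1) (P2 : ocp R X2 U2) : Prop :=
  [/\ (forall W, X2 W -> W !=set0), \bigcup_(W in X2) W = setT &
      vfrr P1 P2 (member X2)].

Definition finite_conservatism (R : realType) (X1 U1 : metricType R)
    (X2 : set (set X1)) (U2 : set U1)
    (P1 : ocp R X1 U1) (P2 : ocp R X2 U2) (rho : R) : Prop :=
  forall (W W' : X2) (u : U2),
  [/\ [set: U1] = cball_set U2 rho,
      tcost P2 W <= rho%:E + esup0 (tcost P1 @` val W),
      rcost P2 W W' u <= rho%:E +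
        esup0 [set rcost P1 p p' (val u) | p in val W & p' in val W'] &
      tcost P1 @` val W `|`
        [set c | exists p q w, val W p /\ c = rcost P1 p q w] <> [set +oo] ->
      P2 W u `<=` [set W'' : X2 |
        set_dist (val W'') (\bigcup_(p in val W) P1 p (val u)) <= rho%:E] /\
      diam (val W) <= rho%:E].

Definition conservatism (R : realType) (X1 U1 : metricType R)
    (X2 : set (set X1)) (U2 : set U1)
    (P1 : ocp R X1 U1) (P2 : ocp R X2 U2) (rho : \bar R) : Prop :=
  [/\ abstraction P1 P2, (forall W, X2 W -> closed W), 0 <= rho &
      forall r : R, rho = r%:E -> finite_conservatism P1 P2 r].

(* Main.v *)
Require Import Defs.
From mathcomp Require Import all_boot all_order all_algebra.
From mathcomp Require Import all_classical all_reals all_analysis.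
From mathcomp Require Import ring lra.

Set Implicit Arguments.
Unset Strict Implicit.
Unset Printing Implicit Defensive.

Import Order.TTheory GRing.Theory Num.Theory.
Import numFieldNormedType.Exports.
Local Open Scope classical_set_scope.
Local Open Scope ring_scope.
Local Open Scope ereal_scope.

(** Write [V_i] for the value function of the i-th abstraction.  Two comparisons
    hold for every [i].  Composing [C_i] with the membership relation gives a
    controller for the original problem, so [V <= L_i]
    ([value_le_refined]).  Conversely, a closed-loop run of the composition is
    shadowed by a run of the abstraction that starts in a cell containing
    [p] and is at least as expensive, so [L_i p] is at most the largest [V_i W]
    over the cells [W] containing [p] ([closed_loop_value_serial_member_le]).  It
    remains to bound [V_i] from above by [V], asymptotically and locally
    uniformly.

    This is done by the method of half-relaxed limits.  Let [upper_limit p] be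
    the limsup of [V_i W] as [i] grows and [W] contains points tending to [p].
    The theorem follows from [upper_limit <= V], and that inequality is a
    consequence of dynamic programming:
    - in the original problem, every nonnegative function [w] with
      [w <= G] and [w p <= sup of g p q u + w q over q in F p u], for every
      input [u], is at most [V]: against any controller, an adversary can choose
      the successors so that the accumulated cost plus [w] stays above any real
      number below its initial value
      ([le_closed_loop_value_of_subsolution]);
    - in the abstractions, [V_i] itself satisfies these inequalities
      ([value_le_tcost], [value_le_step]); the existence of an optimal
      controller makes this immediate, since one may play an arbitrary input
      and then hand over to it.

    The inequalities for [V_i] pass to the limit and yield those for
    [upper_limit] ([upper_limit_le_tcost], [upper_limit_step]).  Indeed, cells with
    some finite cost have diameter at most [rho_i], and cells without have
    infinite value ([finite_cost_of_value]); so wherever the limit bound is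
    finite, cells shrink to points and semicontinuity of [g] and [G] controls
    the abstract costs.  Abstract successors of a cell near [p] under an input
    near [u] are close to [F p u] by semicontinuity of [F], and compactness of
    [F p u] makes the estimates uniform over the successors.

    The resulting local estimate [refined_le_near] says that if [V p < b] then
    [L_i <= b] near [p] for all large [i].  All the claims on a compact set are
    obtained from it by a finite covering. *)

(** * Suprema with value zero on the empty set *)

Section Esup0.
Context {R : realType}.
Implicit Types (A : set (\bar R)) (x M : \bar R).

Lemma le_esup0 A x : A x -> x <= esup0 A.
Proof.
move=> Ax; rewrite /esup0; apply: ge_supremum_Nmem => //.
exact: ereal_supremums_neq0.
Qed.

Lemma esup0_le A M : 0 <= M -> (forall x, A x -> x <= M) -> esup0 A <= M.
Proof.
move=> M0 AM; rewrite /esup0.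
have [->|/eqP A0] := pselect (A = set0); first by rewrite supremum0.
rewrite /supremum (negbTE A0); case: xgetP => [y -> [_ leA]|//].
exact: leA.
Qed.

Lemma esup0_ge0 A : (forall x, A x -> 0 <= x) -> 0 <= esup0 A.
Proof.
move=> A0; have [->|/set0P[x Ax]] := eqVneq A set0.
  by rewrite /esup0 supremum0.
by apply: le_trans (A0 _ Ax) _; exact: le_esup0.
Qed.

End Esup0.

(** * Costs and the verification principle *)

Section Cost.
Context {R : realType} {X U : Type} (P : ocp R X U).
Implicit Types (u : nat -> U) (v : nat -> bool) (x : nat -> X).

Variant first_stop v : Prop :=
| NeverStop of forall t, ~~ v t
| FirstStop T of v T & forall t, (t < T)%N -> ~~ v t.

Lemma first_stopP v : first_stop v.
Proof.
have [vt|nv] := pselect (exists t, v t).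
  have [T vT minT] := ex_minnP vt; apply: (FirstStop vT) => t.
  by apply: contraTN => /minT; rewrite -leqNgt.
by apply: NeverStop => t; apply/negP => vt; apply: nv; exists t.
Qed.

Lemma cost_never u v x : (forall t, ~~ v t) -> cost P u v x = +oo.
Proof.
move=> nv; rewrite /cost; case: pselect => // vt.
by have [t] := vt; rewrite (negPf (nv t)).
Qed.

Lemma cost_first u v x (T : nat) : v T -> (forall t, (t < T)%N -> ~~ v t) ->
  cost P u v x =
    tcost P (x T) + \sum_(0 <= t < T) rcost P (x t) (x t.+1) (u t).
Proof.
move=> vT nv; rewrite /cost; case: pselect => [vt|]; last by case; exists T.
case: ex_minnP => S vS minS; suff -> : S = T by [].
apply/eqP; rewrite eqn_leq minS//= leqNgt.
by apply: contraL vS => /nv.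
Qed.

Lemma cost_ge0 u v x : 0 <= cost P u v x.
Proof.
have [nv|T vT nv] := first_stopP v; first by rewrite cost_never// leey.
rewrite (cost_first _ _ vT nv) adde_ge0 ?tcost_ge0//.
by apply: sume_ge0 => t _; exact: rcost_ge0.
Qed.

Lemma cost_step u v x : ~~ v 0%N ->
  cost P u v x = rcost P (x 0%N) (x 1%N) (u 0%N) +
    cost P (fun t => u t.+1) (fun t => v t.+1) (fun t => x t.+1).
Proof.
move=> v0; have [nv|T vT nv] := first_stopP (fun t => v t.+1).
  rewrite !cost_never//; last by case.
  by rewrite addey// gt_eqF// (lt_le_trans _ (rcost_ge0 _ _ _ _))// ltNy0.
rewrite (cost_first _ _ vT nv) (@cost_first _ _ _ T.+1)//; last by case.
rewrite big_nat_recl// addeCA//.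
Qed.

Lemma closed_loop_value_ge0 (C : controller X U) (p : X) :
  0 <= closed_loop_value P C p.
Proof. by apply: esup0_ge0 => j [u [v [x [_ _ ->]]]]; exact: cost_ge0. Qed.

Lemma value_ge0 (p : X) : 0 <= value P p.
Proof.
by apply: le_ereal_inf_tmp => l [C [_ ->]]; exact: closed_loop_value_ge0.
Qed.

Lemma value_le_closed_loop (C : controller X U) (p : X) :
  is_controller C -> value P p <= closed_loop_value P C p.
Proof. by move=> isC; apply: ereal_inf_lbound; exists C. Qed.

(** Verification principle.  If the closed-loop value at [p] were below [W p], fix
    a real [a] strictly between them.  The hypothesis on [W] lets an adversary
    select successors such that the accumulated cost plus [W] at the current
    state stays above [a]; since [W] is below the terminal cost, the run costs
    at least [a] if it stops, and its cost is infinite otherwise.  The step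
    condition is the inequality [W p <= sup (g + W)], phrased through real upper
    bounds so that no supremum has to be formed. *)
Lemma le_closed_loop_value_of_subsolution (W : X -> \bar R) :
  (forall p, 0 <= W p) -> (forall p, W p <= tcost P p) ->
  (forall p (u : U) (M : R),
     (forall q, P p u q -> rcost P p q u + W q <= M%:E) -> W p <= M%:E) ->
  forall C p, is_controller C -> W p <= closed_loop_value P C p.
Proof.
move=> W0 WG WT C p [[z0 Z0z0] _ _ Hne HU].
rewrite leNgt; apply/negP => LW.
have [a La aW] : exists2 a : R, closed_loop_value P C p < a%:E & a%:E < W p.
  have L0 := closed_loop_value_ge0 C p.
  have : closed_loop_value P C p \is a fin_num.
    by rewrite ge0_fin_numE// (lt_le_trans LW)// leey.
  move=> /fineK Lf; move: LW; rewrite -Lf; set l := fine _.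
  case: (W p) => [w|_|//].
    rewrite lte_fin => lw; exists ((l + w) / 2)%R; rewrite lte_fin ?midf_lt//.
  by exists (l + 1)%R; rewrite ?ltry// lte_fin ltrDl.
(* If every successor violated the invariant, then [W x <= a - c], where [c] is
   finite because it is itself at most [a]. *)
have step (s : cZ C * X * \bar R) : exists r : cZ C * X * \bar R * U * bool,
    [/\ cH C s.1.1 (cin C s.1.2) (r.1.1.1.1, r.1.2, r.2),
        P s.1.2 r.1.2 r.1.1.1.2,
        r.1.1.2 = s.2 + rcost P s.1.2 r.1.1.1.2 r.1.2 &
        0 <= s.2 -> a%:E < s.2 + W s.1.2 ->
          a%:E < r.1.1.2 + W r.1.1.1.2].
  case: s => [[z x] c] /=; have [[[z' u] v] Hzx] := Hne z (cin C x).
  have [[q [Fq aq]]|noq] := pselect (exists q, P x u q /\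
    a%:E < c + rcost P x q u + W q).
    by exists (z', q, c + rcost P x q u, u, v).
  have [q Fq] := trans_neq0 P x u.
  exists (z', q, c + rcost P x q u, u, v); split => //= c0 acW; exfalso.
  have le_a q' : P x u q' -> c + rcost P x q' u + W q' <= a%:E.
    by move=> Fq'; rewrite leNgt; apply/negP => aq'; apply: noq; exists q'.
  have ca : c <= a%:E.
    apply: le_trans (le_a q Fq); rewrite -addeA leeDl// adde_ge0//.
    exact: rcost_ge0.
  have cf : c \is a fin_num by rewrite ge0_fin_numE// (le_lt_trans ca)// ltry.
  have : W x <= (a - fine c)%:E.
    apply: (WT x u) => q' /le_a; rewrite EFinB fineK//.
    by rewrite -addeA leeBrDl.
  by rewrite EFinB fineK// leeBrDl// leNgt acW.
(* The components of a state of the run are the controller state, the system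
   state and the cost accumulated so far. *)
have [f fP] := choice step.
pose s := fix s n := if n is n'.+1 then (f (s n')).1.1 else (z0, p, 0).
pose u t := (f (s t)).1.2; pose v t := (f (s t)).2; pose x t := (s t).1.2.
have beh : behavior C P u v x.
  split; last by move=> t; have [] := fP (s t).
  exists (fun t => (s t).1.1); split => // t; last by have [] := fP (s t).
  by have [/HU] := fP (s t).
have accE t : (s t).2 = \sum_(0 <= k < t) rcost P (x k) (x k.+1) (u k).
  elim: t => [|t IH]; first by rewrite big_geq.
  by rewrite big_nat_recr//= -IH; have [_ _ ->] := fP (s t).
have inv t : a%:E < (s t).2 + W (x t).
  elim: t => [|t IH]; first by rewrite /= add0e.
  have [_ _ _] := fP (s t); apply => //.
  by rewrite accE; apply: sume_ge0 => k _; exact: rcost_ge0.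
have : cost P u v x <= closed_loop_value P C p.
  by apply: le_esup0; exists u, v, x.
apply/negP; rewrite -ltNge (lt_le_trans La)//.
have [nv|T vT nv] := first_stopP v; first by rewrite cost_never// leey.
rewrite (cost_first _ _ vT nv) -accE addeC (le_trans (ltW (inv T)))//.
by rewrite leeD2l.
Qed.

End Cost.

(** * Dynamic programming bounds from special controllers *)

Section Controllers.
Context {R : realType} {X U : Type} (P : ocp R X U).
Implicit Types (C : controller X U) (p : X).

Definition stop_controller : controller X U :=
  @Controller X U unit setT X id setT (fun _ _ => [set w | w.2 = true]).

Lemma value_le_tcost p : value P p <= tcost P p.
Proof.
have [u0 _] := input_neq0 P.
apply: (@le_trans _ _ (closed_loop_value P stop_controller p)).
  apply: value_le_closed_loop; split => //=; first by exists tt.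
    by exists u0.
  by move=> z y; exists (tt, u0, true).
apply: esup0_le => [|j [u [v [x [[[z [_ _ /= vT]] _] x0 ->]]]]].
  exact: tcost_ge0.
by rewrite (@cost_first _ _ _ _ _ _ _ 0 (vT 0%N))// x0 big_geq// adde0.
Qed.

(** Applies the input [u] once, whatever the state, and then behaves as [C]:
    the state [None] marks the first instant. *)
Definition delay_controller (u : U) C : controller X U :=
  @Controller X U (option (cZ C)) [set None] (cX C) (cin C) setT
    (fun z y => if z is Some z'
      then [set (Some w.1.1, w.1.2, w.2) | w in cH C z' y]
      else [set (Some z0, u, false) | z0 in cZ0 C]).

Lemma delay_is_controller u C :
  is_controller C -> is_controller (delay_controller u C).
Proof.
move=> [[z0 Z0z0] inj [u0 _] Hne _]; split => //=; first by exists None.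
  by exists u0.
case=> [z|] y; last by exists (Some z0, u, false); exists z0.
by have [w Hw] := Hne z y; exists (Some w.1.1, w.1.2, w.2); exists w.
Qed.

Lemma value_le_step C p (u : U) (M : \bar R) : is_controller C ->
  (forall q, P p u q -> rcost P p q u + closed_loop_value P C q <= M) ->
  value P p <= M.
Proof.
move=> isC leM.
apply: le_trans (value_le_closed_loop P p (delay_is_controller u isC)) _.
apply: esup0_le => [|j [u' [v [x [[[z [_ zE /= zH]] Sx] x0 ->]]]]].
  have [q Fq] := trans_neq0 P p u.
  apply: le_trans (leM q Fq).
  by rewrite adde_ge0 ?rcost_ge0// closed_loop_value_ge0.
have [z0 Z0z0 [z1E u0E v0E]] : exists2 z0, cZ0 C z0 &
    [/\ z 1%N = Some z0, u' 0%N = u & v 0%N = false].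
  by move: (zH 0%N); rewrite zE => -[z0 Z0z0 [<- <- <-]]; exists z0.
rewrite cost_step; last by rewrite v0E.
rewrite x0 u0E; apply: le_trans (leM (x 1%N) _); last first.
  by have := Sx 0%N; rewrite x0 u0E.
apply: leeD2l; apply: le_esup0.
exists (fun t => u' t.+1), (fun t => v t.+1), (fun t => x t.+1).
split => //; split; last by move=> t; exact: Sx.
pose z' t := if z t.+1 is Some y then y else z0.
have zS t : z t.+1 = Some (z' t).
  rewrite /z'; elim: t => [|t IH]; first by rewrite z1E.
  by move: (zH t.+1); rewrite IH => -[w _ [<-]].
have H t : cH C (z' t) (cin C (x t.+1)) (z' t.+1, u' t.+1, v t.+1).
  by move: (zH t.+1); rewrite !zS => -[[[z1 u1] v1] Hw [<- <- <-]].
exists z'; split => // [t|]; last by rewrite /z' z1E.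
by have [_ _ _ _ HU] := isC; have := HU _ _ _ (H t).
Qed.

End Controllers.

(** * Refinement of a controller along the membership relation *)

Section Refinement.
Context {R : realType} {X U : Type} {X2 : set (set X)} {U2 : set U}.
Context {P : ocp R X U} {P2 : ocp R X2 U2} {C : controller X2 U2}.
Hypotheses (absP : abstraction P P2) (isC : is_controller C).

Lemma serial_member_is_controller : is_controller (serial_member C).
Proof.
have [_ _ [Qstrict _]] := absP; have [Z0ne inj [u Cu] Hne HU] := isC.
split => //=; first by exists (val u); exists u.
  move=> z p; have [W Wp] := Qstrict p; have [w Hw] := Hne z (cin C W).
  exists (w.1.1, val w.1.2, w.2); exists w => //.
  by exists (cin C W) => //; exists W.
by move=> z p _ [w [_ [W _ <-] Hw] <-] /=; exists w.1.2 => //; exact: HU Hw.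
Qed.

(** Each run of the refined loop selects, at every instant, a cell containing the
    current state.  These cells form a run of the abstract loop because the
    membership relation maps transitions to transitions, and the cost of that
    run dominates termwise. *)
Lemma closed_loop_value_serial_member_le p (M : \bar R) :
  (forall W : X2, val W p -> closed_loop_value P2 C W <= M) ->
  closed_loop_value P (serial_member C) p <= M.
Proof.
move=> leM; have [_ _ [Qstrict Q]] := absP; have [_ _ _ _ HU] := isC.
apply: esup0_le => [|j [u [v [x [[[z [_ zZ0 /= zH]] Sx] x0 ->]]]]].
  have [W Wp] := Qstrict p; apply: le_trans (leM W Wp).
  exact: closed_loop_value_ge0.
have abs t : exists r : X2 * U2, [/\ val r.1 (x t), val r.2 = u t &
    cH C (z t) (cin C r.1) (z t.+1, r.2, v t)].
  have [[[z' u'] v'] [_ [W Wx <-] Hw] [zE uE vE]] := zH t.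
  by exists (W, u'); rewrite -zE -vE.
have [r rP] := choice abs.
pose W t := (r t).1; pose u' t := (r t).2.
have Wx t : val (W t) (x t) by have [] := rP t.
have u'E t : val (u' t) = u t by have [] := rP t.
have HW t : cH C (z t) (cin C (W t)) (z t.+1, u' t, v t) by have [] := rP t.
have beh : behavior C P2 u' v W.
  split=> [|t]; first by exists z; split => // t; exact: HU (HW t).
  have [_ _] := Q _ _ _ _ (u' t) (Wx t) (Wx t); apply.
  exists (x t.+1); last exact: Wx.
  by have := Sx t; rewrite -u'E.
apply: (@le_trans _ _ (cost P2 u' v W)); last first.
  apply: le_trans (leM (W 0%N) _); last by rewrite -x0.
  by apply: le_esup0; exists u', v, W.
have [nv|T vT nv] := first_stopP v; first by rewrite !cost_never.
rewrite !(cost_first _ _ _ vT nv); apply: leeD.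
  by have [] := Q _ _ _ _ (u' T) (Wx T) (Wx T).
apply: lee_sum => t _.
by have [_] := Q _ _ _ _ (u' t) (Wx t) (Wx t.+1); rewrite u'E.
Qed.

End Refinement.

(** * Cells of an abstraction *)

Section Cells.
Context {R : realType}.

(** The verification principle applied to the function that is infinite at [p]
    and zero elsewhere. *)
Lemma value_infinite (X U : Type) (P : ocp R X U) p : tcost P p = +oo ->
  (forall q u, P p u q -> rcost P p q u = +oo) -> value P p = +oo.
Proof.
move=> Gp gp; pose W q : \bar R := if `[< q = p >] then +oo else 0.
have W0 q : 0 <= W q by rewrite /W; case: ifP.
apply/eqP; rewrite eq_le leey/=; apply: le_ereal_inf_tmp => _ [C [isC ->]].
have -> : +oo = W p by rewrite /W asboolT.
apply: (le_closed_loop_value_of_subsolution W0) => // [q|q u M leM].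
  by rewrite /W; case: asboolP => [->|_]; rewrite ?Gp ?tcost_ge0.
have [q' Fq'] := trans_neq0 P q u.
apply: le_trans (leM _ Fq'); rewrite {1}/W; case: asboolP => [qp|_].
  by subst q; rewrite gp// addye// gt_eqF// (lt_le_trans _ (W0 _))// ltNy0.
by rewrite adde_ge0// rcost_ge0.
Qed.

Context {X U : metricType R} {X2 : set (set X)} {U2 : set U}.
Context {P : ocp R X U} {P2 : ocp R X2 U2} {rho : R}.
Hypotheses (absP : abstraction P P2) (consP : finite_conservatism P P2 rho).

(** The condition under which the definition of conservatism constrains the
    diameter and the successors of a cell. *)
Definition has_finite_cost (W : set X) : Prop :=
  exists2 p, W p & tcost P p < +oo \/ exists q w, rcost P p q w < +oo.

(** Abstract costs dominate the original ones, so in a cell where all original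
    costs are infinite one can neither stop nor move at finite cost. *)
Lemma finite_cost_of_value (W : X2) :
  value P2 W < +oo -> has_finite_cost (val W).
Proof.
have [ne cov [_ Q]] := absP; move=> VW; apply: contrapT => nfin.
suff VWy : value P2 W = +oo by rewrite VWy ltxx in VW.
have infE (p : X) :
    val W p -> tcost P p = +oo /\ forall q w, rcost P p q w = +oo.
  move=> Wp; split=> [|q w]; apply/eqP; rewrite -leye_eq leNgt;
    apply/negP => fin; apply: nfin; exists p => //; [left|right] => //.
  by exists q, w.
have [p Wp] : val W !=set0 by apply: ne; exact: set_valP.
have [Gp gp] := infE p Wp.
apply: value_infinite => [|W' u _].
  have [u _] := input_neq0 P2.
  by apply/eqP; rewrite -leye_eq -Gp; have [] := Q _ _ _ _ u Wp Wp.
have [q W'q] : val W' !=set0 by apply: ne; exact: set_valP.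
apply/eqP; rewrite -leye_eq -(gp q (val u)).
by have [] := Q _ _ _ _ u Wp W'q.
Qed.

Lemma conservatism_cell (W : X2) (u : U2) : has_finite_cost (val W) ->
  P2 W u `<=` [set W'' : X2 |
    set_dist (val W'') (\bigcup_(p in val W) P p (val u)) <= rho%:E] /\
  diam (val W) <= rho%:E.
Proof.
move=> [p Wp fin]; have [_ _ _] := consP W W u; apply => eqy.
have notin c : c < +oo -> ~ (tcost P @` val W `|`
    [set c | exists p q w, val W p /\ c = rcost P p q w]) c.
  by move=> cy; rewrite eqy /= => cE; rewrite cE ltxx in cy.
case: fin => [Gp|[q [w gp]]]; first by apply: (notin _ Gp); left; exists p.
by apply: (notin _ gp); right; exists p, q, w.
Qed.

Lemma mdist_cell (W : X2) (p q : X) : has_finite_cost (val W) ->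
  val W p -> val W q -> (mdist p q <= rho)%R.
Proof.
have [u _] := input_neq0 P2.
move=> fin Wp Wq; have [_ diamW] := conservatism_cell u fin.
rewrite -lee_fin; apply: le_trans diamW; apply: le_esup0.
by exists p => //; exists q.
Qed.

End Cells.
Arguments has_finite_cost {R X U} P W.

(** * Semicontinuity, compactness and convergence in metric terms *)

Section Scale.
Context {R : realType}.

(** Neighbourhoods of [(infinity, p)] are indexed by a single number [k], which
    stands for the indices [i >= k] and the points at distance less than
    [scale k] from [p]. *)
Definition scale (k : nat) : R := (k.+1%:R^-1)%R.

Lemma scale_gt0 k : (0 < scale k)%R.
Proof. by rewrite /scale invr_gt0 ltr0n. Qed.

Lemma ler_scale k l : (k <= l)%N -> (scale l <= scale k)%R.
Proof. by move=> kl; rewrite /scale lef_pV2 ?posrE ?ltr0n// ler_nat. Qed.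

Lemma scale_small (e : R) : (0 < e)%R ->
  exists k0, forall k, (k0 <= k)%N -> (scale k < e)%R.
Proof.
by move=> e0; have [k _ kP] := near_infty_natSinv_lt (PosNum e0); exists k.
Qed.

Lemma near_scale {X : metricType R} (p : X) (A : set X) : nbhs p A ->
  exists k, forall q, (mdist p q < scale k)%R -> A q.
Proof.
move=> /nbhs_ballP[e /= e0 eA]; have [k kP] := scale_small e0.
exists k => q pq; apply: eA; rewrite ballEmdist/=.
exact: lt_trans pq (kP _ (leqnn k)).
Qed.

Lemma usc_lt {T : topologicalType} (f : T -> \bar R) x (b : R) :
  usc f -> f x < b%:E -> \forall y \near x, f y < b%:E.
Proof.
move=> uscf fxb.
have : nbhs (x, b) (~` [set y : T * R | y.2%:E <= f y.1]).
  apply: open_nbhs_nbhs; split; first exact: closed_openC.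
  by apply/negP; rewrite -ltNge.
move=> [[A B] /= [xA bB]] AB; apply: filterS xA => y Ay.
rewrite ltNge; apply/negP; apply: (AB (y, b)); split => //=.
exact: nbhs_singleton bB.
Qed.

(** Local validity of an eventually stable property on a compact set is uniform
    in [k]; this is the only form in which compactness is used. *)
Lemma compact_uniform {X : metricType R} (K : set X) (Q : nat -> X -> Prop) :
  compact K ->
  (forall k l q, (k <= l)%N -> Q k q -> Q l q) ->
  (forall q, K q -> exists k, forall q', (mdist q q' < scale k)%R -> Q k q') ->
  exists k, forall q, K q -> Q k q.
Proof.
move=> /compact_near_coveringP cK Qmono Qloc.
have [k _ kP] : \forall k \near \oo, K `<=` Q k.
  apply: cK => q /Qloc[k kP].
  exists (ball q (scale k), [set l | (k <= l)%N]) => /=.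
    by split; [exact: nbhsx_ballx (scale_gt0 k)|exists k].
  move=> [q' l] [/= qq' kl]; apply: Qmono kl _; apply: kP.
  by move: qq'; rewrite ballEmdist.
by exists k => q; apply: kP => /=.
Qed.

Lemma cvge_from_above (u : nat -> \bar R) (l : \bar R) : 0 <= l ->
  (forall i, l <= u i) ->
  (forall b : R, l < b%:E -> \forall i \near \oo, u i <= b%:E) ->
  u i @[i --> \oo] --> l.
Proof.
case: l => [l _ lu ub|_ lu _|//]; last first.
  have -> : u = fun=> +oo by apply/funext => i; apply/eqP; rewrite -leye_eq.
  exact: cvg_cst.
move=> A Al.
have /nbhs_ballP[e /= e0 eA] : nbhs l (fun r => A r%:E) by [].
have [|k _ kP] := ub (l + e / 2)%R; first by rewrite lte_fin ltrDl divr_gt0.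
exists k => // i /= ki; have := kP i ki; have := lu i.
case: (u i) => [r| |]//; rewrite !lee_fin => lr rl.
by apply: eA; rewrite -ball_normE /= ltr_norml; apply/andP; split; lra.
Qed.

End Scale.

(** * The half-relaxed upper limit of the abstract value functions *)

Section Limit.
Context {R : realType} {X U : metricType R} {P : ocp R X U}.
Context {Xi : nat -> set (set X)} {Ui : nat -> set U}.
Context {Pi : forall i, ocp R (Xi i) (Ui i)} {rho : nat -> \bar R}.
Context {Ci : forall i, controller (Xi i) (Ui i)}.
Hypothesis F_compact : forall p u, compact (P p u).
Hypothesis g_usc : usc (fun y : X * X * U => rcost P y.1.1 y.1.2 y.2).
Hypothesis G_usc : usc (tcost P).
Hypothesis F_usc : usc_map (fun y : X * U => P y.1 y.2).
Hypothesis Pi_conservatism : forall i, conservatism P (Pi i) (rho i).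
Hypothesis Ci_optimal : forall i, optimal (Pi i) (Ci i).
Hypothesis rho_cvg0 : rho i @[i --> \oo] --> 0.

Local Notation L i := (closed_loop_value P (serial_member (Ci i))).

Let Pi_abstraction i : abstraction P (Pi i).
Proof. by have [] := Pi_conservatism i. Qed.

Let Ci_controller i : is_controller (Ci i).
Proof. by have [] := Ci_optimal i. Qed.

Lemma conservatism_scale (e : R) (k0 : nat) : (0 < e)%R ->
  exists k, [/\ (k0 <= k)%N, (scale k < e)%R & forall i, (k <= i)%N ->
    exists r : R, finite_conservatism P (Pi i) r /\ (r < e)%R].
Proof.
move=> e0; have [k1 k1P] := scale_small e0.
have [k2 _ k2P] : \forall i \near \oo, rho i < e%:E.
  have e0' : 0 < e%:E by rewrite lte_fin.
  exact: rho_cvg0 (open_ereal_lt' e0').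
exists (maxn k0 (maxn k1 k2)); split; first exact: leq_maxl.
  by apply: k1P; rewrite !leq_max leqnn orbT.
move=> i; rewrite !geq_max => /and3P[_ _ k2i].
have [_ _ rho0 fin] := Pi_conservatism i.
have rhoe : rho i < e%:E by exact: k2P.
have rhof : rho i \is a fin_num.
  by rewrite ge0_fin_numE// (lt_trans rhoe)// ltry.
exists (fine (rho i)); split; first by apply: fin; rewrite fineK.
by rewrite -lte_fin fineK.
Qed.

Lemma rcost_near p q u (b : R) : rcost P p q u < b%:E ->
  exists k, forall p' q' u', (mdist p p' < scale k)%R ->
    (mdist q q' < scale k)%R -> (mdist u u' < scale k)%R ->
    rcost P p' q' u' < b%:E.
Proof.
move=> gb; have /nbhs_ballP[e /= e0 eP] := usc_lt (x := (p, q, u)) g_usc gb.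
have [k kP] := scale_small e0; exists k => p' q' u' pp' qq' uu'.
apply: (eP (p', q', u')); split => /=; last first.
  by rewrite ballEmdist /= (lt_trans uu')// kP.
by split => /=; rewrite ballEmdist /= ?(lt_trans pp') ?(lt_trans qq')// kP.
Qed.

Definition locally_bounded p (b : \bar R) k : Prop :=
  forall i q, (k <= i)%N -> (mdist p q < scale k)%R ->
  forall W : Xi i, val W q -> value (Pi i) W <= b.

Definition upper_limit p : \bar R :=
  ereal_inf [set b | exists k, locally_bounded p b k].

Lemma upper_limit_lt p b : upper_limit p < b -> exists k, locally_bounded p b k.
Proof.
move=> /ereal_inf_lt[b' [k kP] b'b]; exists k => i q ki pq W Wq.
exact: le_trans (kP i q ki pq W Wq) (ltW b'b).
Qed.

Lemma upper_limit_ge0 p : 0 <= upper_limit p.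
Proof.
apply: le_ereal_inf_tmp => b [k kP].
have [_ _ [Qstrict _]] := Pi_abstraction k.
have [W Wp] := Qstrict p.
apply: le_trans (kP k p (leqnn k) _ W Wp); first exact: value_ge0.
by rewrite mdistxx scale_gt0.
Qed.

(** Stopping at once is allowed in the abstraction.  If [G p] is finite, then so
    is [G] near [p], hence cells near [p] are small and their terminal cost is
    at most [rho_i] plus a supremum of [G] over a small set near [p]. *)
Lemma upper_limit_le_tcost p : upper_limit p <= tcost P p.
Proof.
have [->|Gy] := eqVneq (tcost P p) +oo; first exact: leey.
have Gf : tcost P p \is a fin_num by rewrite ge0_fin_numE ?tcost_ge0// ltey.
apply/lee_addgt0Pr => e e0; rewrite -(fineK Gf) -EFinD; set c := fine _.
have [k1 k1P] : exists k1, forall q, (mdist p q < scale k1)%R ->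
    tcost P q < (c + e / 2)%:E.
  apply: near_scale; apply: usc_lt => //.
  by rewrite -(fineK Gf) lte_fin ltrDl divr_gt0.
have [|k [_ sk kP]] := @conservatism_scale (Num.min (scale k1 / 2) (e / 2))%R 0.
  by rewrite lt_min !divr_gt0// scale_gt0.
move: sk; rewrite lt_min => /andP[sk1 _].
apply: ereal_inf_lbound; exists k => i q ki pq W Wq.
have [r [cons]] := kP i ki; rewrite lt_min => /andP[rs re].
have pq1 : (mdist p q < scale k1)%R.
  have s0 : (0 < scale k1 :> R)%R := scale_gt0 k1.
  by lra.
have Gq := k1P q pq1.
have fin : has_finite_cost P (val W).
  by exists q => //; left; rewrite (lt_trans Gq)// ltry.
have [u _] := input_neq0 (Pi i).
have [_ GW _ _] := cons W W u.
apply: le_trans (value_le_tcost _ _) _; apply: le_trans GW _.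
apply: (@le_trans _ _ (r%:E + (c + e / 2)%:E)); last first.
  by rewrite -EFinD lee_fin; lra.
apply: leeD2l; apply: esup0_le.
  by apply: le_trans (ltW Gq); exact: tcost_ge0.
move=> _ [q' Wq' <-]; apply/ltW/k1P.
have := mdist_cell cons fin Wq Wq'.
by have := metric_triangle p q q'; lra.
Qed.

Lemma transition_near p u (e : R) : (0 < e)%R ->
  exists k, forall p' u', (mdist p p' < scale k)%R -> (mdist u u' < scale k)%R ->
    P p' u' `<=` [set x | exists2 q, P p u q & (mdist q x < e)%R].
Proof.
move=> e0; pose O := \bigcup_(q in P p u) ball q e.
have clO : closed [set y : X * U | P y.1 y.2 `&` ~` O° !=set0].
  exact: F_usc (open_closedC (open_interior O)).
have : nbhs (p, u) (~` [set y : X * U | P y.1 y.2 `&` ~` O° !=set0]).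
  apply: open_nbhs_nbhs; split; first exact: closed_openC.
  move=> [q /= [Fq]]; apply; apply: (@filterS _ _ _ (ball q e)) => [x qx|].
    by exists q.
  exact: nbhsx_ballx.
move=> /nbhs_ballP[d /= d0 dP]; have [k kP] := scale_small d0.
exists k => p' u' pp' uu' x Fx; apply: contrapT => nx.
apply: (dP (p', u')).
  by split => /=; rewrite ballEmdist /= ?(lt_trans pp') ?(lt_trans uu')// kP.
exists x; split => // /interior_subset[q Fq qx]; apply: nx; exists q => //.
by move: qx; rewrite ballEmdist.
Qed.

(** Bounds the abstract cost-to-go of one step from a cell [W] near [p], with an
    input near [u], into a cell [W'] that meets the ball around [q]. *)
Definition step_bounded p u (b : \bar R) k q : Prop :=
  forall i (W W' : Xi i) (w : Ui i), (k <= i)%N ->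
    (forall p', val W p' -> mdist p p' < scale k)%R ->
    (mdist u (val w) < scale k)%R ->
    (exists2 y, val W' y & (mdist q y < scale k)%R) ->
    rcost (Pi i) W W' w + value (Pi i) W' <= b.

(** The finiteness of [upper_limit q] forces the cells [W'] near [q] to have finite
    abstract value, hence to be small; then [g] is evaluated near [(p, q, u)]
    only.  The slack [e] is split evenly between [rho_i], the semicontinuity of
    [g], and the excess of the abstract value over [upper_limit q]. *)
Lemma step_bounded_near p u q (M e : R) : (0 < e)%R ->
  rcost P p q u + upper_limit q <= M%:E ->
  exists k, forall q', (mdist q q' < scale k)%R ->
    step_bounded p u (M + e)%:E k q'.
Proof.
move=> e0 leM.
have g0 := rcost_ge0 P p q u; have W0 := upper_limit_ge0 q.
have gf : rcost P p q u \is a fin_num.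
  rewrite ge0_fin_numE// (le_lt_trans _ (ltry M))//.
  by rewrite (le_trans _ leM)// leeDl.
have Wf : upper_limit q \is a fin_num.
  rewrite ge0_fin_numE// (le_lt_trans _ (ltry M))//.
  by rewrite (le_trans _ leM)// leeDr.
move: leM; rewrite -(fineK gf) -(fineK Wf) -EFinD lee_fin.
set c := fine (rcost _ _ _ _); set w := fine (upper_limit q) => leM.
have [|k1 k1P] := @upper_limit_lt q (w + e / 3)%:E.
  by rewrite -(fineK Wf) lte_fin ltrDl divr_gt0.
have [|k2 k2P] := @rcost_near p q u (c + e / 3).
  by rewrite -(fineK gf) lte_fin ltrDl divr_gt0.
have s10 : (0 < scale k1 :> R)%R := scale_gt0 k1.
have s20 : (0 < scale k2 :> R)%R := scale_gt0 k2.
have [|k [k1k sk kP]] := @conservatism_scale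
  (Num.min (scale k1 / 2) (Num.min (scale k2 / 3) (e / 3)))%R k1.
  by rewrite !lt_min !divr_gt0.
move: sk; rewrite !lt_min => /and3P[sk1 sk2 _].
exists k => q' qq' i W W' u' ki Wp uu' [y W'y q'y].
have qy : (mdist q y < scale k + scale k)%R.
  by rewrite (le_lt_trans (metric_triangle _ q' _))// ltrD.
have [r [cons]] := kP i ki; rewrite !lt_min => /and3P[_ rs re].
have VW' : value (Pi i) W' <= (w + e / 3)%:E.
  by apply: (k1P i y) => //; [exact: leq_trans ki|lra].
have fin : has_finite_cost P (val W').
  apply: (finite_cost_of_value (Pi_abstraction i)).
  by rewrite (le_lt_trans VW')// ltry.
have [_ _ gW _] := cons W W' u'.
have -> : (M + e = (M - c - w) + (e / 3 + (c + e / 3)) + (w + e / 3))%R by field.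
rewrite EFinD; apply: leeD => //; apply: le_trans gW _.
apply: (@le_trans _ _ (r%:E + (c + e / 3)%:E)); last first.
  by rewrite -EFinD lee_fin; lra.
apply: leeD2l; apply: esup0_le.
  by rewrite lee_fin addr_ge0 ?fine_ge0// divr_ge0// ltW.
move=> _ [p' Wp' [q2 W'q2 <-]]; apply/ltW/k2P.
- by have := Wp p' Wp'; lra.
- have := mdist_cell cons fin W'y W'q2.
  by have := metric_triangle q y q2; lra.
- by lra.
Qed.

(** The dynamic programming inequality of [V_i] passes to the limit.  Given [u], a
    cell [W] near [p] is played with an abstract input within [rho_i] of [u];
    its abstract successors meet the [scale K]-neighbourhood of [F p u], on
    which [step_bounded_near] holds uniformly by compactness. *)
Lemma upper_limit_step p u (M : R) :
  (forall q, P p u q -> rcost P p q u + upper_limit q <= M%:E) ->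
  upper_limit p <= M%:E.
Proof.
move=> leM; apply/lee_addgt0Pr => e e0; rewrite -EFinD.
have [K KP] : exists k, forall q, P p u q -> step_bounded p u (M + e)%:E k q.
  apply: compact_uniform => // [k l q kl bk i W W' w li Wp uw [y W'y qy]|q Fq].
    have sl := @ler_scale R _ _ kl.
    apply: bk; first exact: leq_trans li.
    - by move=> p' /Wp /lt_le_trans; apply.
    - exact: lt_le_trans sl.
    - by exists y => //; exact: lt_le_trans sl.
  exact: step_bounded_near (leM q Fq).
have sK0 : (0 < scale K :> R)%R := scale_gt0 K.
(* One successor of finite running cost suffices to make the cells near [p]
   small. *)
have [q0 Fq0] := trans_neq0 P p u.
have [b gb] : exists b : R, rcost P p q0 u < b%:E.
  exists (M + 1)%R.
  apply: (@le_lt_trans _ _ M%:E); last by rewrite lte_fin ltrDl.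
  by apply: le_trans (leM q0 Fq0); rewrite leeDl// upper_limit_ge0.
have [k3 k3P] := @transition_near p u (scale K / 2) (divr_gt0 sK0 (ltr0n _ 2)).
have [k4 k4P] := rcost_near gb.
have s30 : (0 < scale k3 :> R)%R := scale_gt0 k3.
have s40 : (0 < scale k4 :> R)%R := scale_gt0 k4.
have [|k [Kk sk kP]] := @conservatism_scale
  (Num.min (scale k3 / 2) (Num.min (scale k4) (scale K / 2)))%R K.
  by rewrite !lt_min s40 !divr_gt0.
move: sk; rewrite !lt_min => /and3P[sk3 sk4 skK].
apply: ereal_inf_lbound; exists k => i q ki pq W Wq.
have [r [cons]] := kP i ki; rewrite !lt_min => /and3P[r3 r4 rK].
have fin : has_finite_cost P (val W).
  exists q => //; right; exists q0, u; apply: (lt_trans _ (ltry b)).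
  by apply: k4P; rewrite ?mdistxx//; lra.
have Wnear p' : val W p' -> (mdist p p' < scale k + r)%R.
  move=> Wp'; have := mdist_cell cons fin Wq Wp'.
  by have := metric_triangle p q p'; lra.
have [c Uc cu] : exists2 c, Ui i c & (mdist c u <= r)%R.
  have [w0 _] := input_neq0 (Pi i).
  have [UE _ _ _] := cons W W w0.
  have : cball_set (Ui i) r u by rewrite -UE.
  by move=> [c Uc cu]; exists c.
pose w : Ui i := SigSub (mem_set Uc).
have uw : (mdist u (val w) <= r)%R by rewrite metric_sym.
apply: (@value_le_step _ _ _ _ (Ci i) _ w) => // W' FW'.
have [_ ->] := Ci_optimal i.
have [/(_ _ FW') /= dW' _] := conservatism_cell cons w fin.
have [_ [y W'y [x [p' Wp' Fx] <-]]] :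
    exists2 d, [set (mdist x y)%:E | x in val W' &
      y in \bigcup_(p in val W) P p (val w)] d & d < (scale K / 2)%:E.
  by apply: ereal_inf_lt; apply: (le_lt_trans dW'); rewrite lte_fin.
rewrite lte_fin metric_sym => xy.
have [q' Fq' q'x] : exists2 q', P p u q' & (mdist q' x < scale K / 2)%R.
  by apply: k3P Fx; [have := Wnear p' Wp'; lra|lra].
apply: (KP q' Fq') => //.
- exact: leq_trans ki.
- by move=> p2 /Wnear; lra.
- by lra.
- by exists y => //; have := metric_triangle q' x y; lra.
Qed.

Lemma upper_limit_le_value p : upper_limit p <= value P p.
Proof.
apply: le_ereal_inf_tmp => _ [C [isC ->]].
apply: le_closed_loop_value_of_subsolution isC.
- exact: upper_limit_ge0.
- exact: upper_limit_le_tcost.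
- exact: upper_limit_step.
Qed.

Lemma value_le_refined i p : value P p <= L i p.
Proof.
apply: value_le_closed_loop.
exact: serial_member_is_controller (Pi_abstraction i) (Ci_controller i).
Qed.

Lemma refined_le_near p (b : \bar R) : value P p < b ->
  exists k, forall i q, (k <= i)%N -> (mdist p q < scale k)%R -> L i q <= b.
Proof.
move=> /(le_lt_trans (upper_limit_le_value p)) /upper_limit_lt[k kP].
exists k => i q ki pq.
apply: (closed_loop_value_serial_member_le (Pi_abstraction i)) => // W Wq.
by have [_ ->] := Ci_optimal i; exact: kP Wq.
Qed.

End Limit.

(** * Convergence of the refined controllers *)

Theorem mainTheorem11 (R : realType) (X U : metricType R) (P : ocp R X U)
  (X_proper : proper_space X)
  (U_compact : compact [set: U])
  (F_compact : forall p u, compact (P p u))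
  (g_usc : usc (fun y : X * X * U => rcost P y.1.1 y.1.2 y.2))
  (G_usc : usc (tcost P))
  (F_usc : usc_map (fun y : X * U => P y.1 y.2))
  (Xi : nat -> set (set X)) (Ui : nat -> set U)
  (Pi : forall i, ocp R (Xi i) (Ui i))
  (rho : nat -> \bar R)
  (Pi_conservatism : forall i, conservatism P (Pi i) (rho i))
  (Ci : forall i, controller (Xi i) (Ui i))
  (Ci_optimal : forall i, optimal (Pi i) (Ci i))
  (rho_cvg0 : rho i @[i --> \oo] --> 0) :
  let V := value P in
  let L i := closed_loop_value P (serial_member (Ci i)) in
  (forall p, L i p @[i --> \oo] --> V p) /\
  forall N : set X, compact N ->
    (forall eps : R, (0 < eps)%R ->
      \forall i \near \oo, esup0 (L i @` N) <= eps%:E + esup0 (V @` N)) /\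
    ((forall p, N p -> V p \is a fin_num) ->
      esup0 (V @` N) < +oo /\
      ({within N, continuous V} ->
        forall eps : R, (0 < eps)%R ->
          \forall i \near \oo, forall p, N p -> `|L i p - V p| <= eps%:E)).
Proof.
move=> V L.
have VL i p : V p <= L i p by exact: value_le_refined.
have near_ub p b : V p < b ->
    exists k, forall i q, (k <= i)%N -> (mdist p q < scale k)%R -> L i q <= b.
  exact: (refined_le_near F_compact g_usc G_usc F_usc).
have V0 p : 0 <= V p by exact: value_ge0.
have bound_ge0 p b : V p <= b -> 0 <= b by exact: le_trans.
split=> [p|N cN].
  apply: cvge_from_above => // b /near_ub[k kP]; exists k => // i ki.
  by apply: kP => //; rewrite mdistxx scale_gt0.
have [[p0 Np0]|N0] := pselect (N !=set0); last first.
  have sup0 f : esup0 (f @` N) = 0 :> \bar R.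
    suff -> : f @` N = set0 by rewrite /esup0 supremum0.
    by rewrite -subset0 => j [p Np _]; case: N0; exists p.
  split=> [eps eps0|_]; first by near=> i; rewrite !sup0 adde0 lee_fin ltW.
  split=> [|_ eps eps0]; first by rewrite sup0 ltry.
  by near=> i => p Np; case: N0; exists p.
split=> [eps eps0|Vfin].
  have [->|supy] := eqVneq (esup0 (V @` N)) +oo.
    by near=> i; rewrite addey// leey.
  have VS p : N p -> V p <= esup0 (V @` N).
    by move=> Np; apply: le_esup0; exists p.
  have S0 := bound_ge0 _ _ (VS p0 Np0).
  have Sf : esup0 (V @` N) \is a fin_num by rewrite ge0_fin_numE// ltey.
  have [k kP] : exists k, forall q, N q -> forall i, (k <= i)%N ->
      L i q <= eps%:E + esup0 (V @` N).
    apply: compact_uniform => // [k l q kl kP i li|p Np].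
      by apply: kP; exact: leq_trans li.
    have [|k kP] := near_ub p (eps%:E + esup0 (V @` N)).
      by apply: le_lt_trans (VS p Np) _; rewrite lteDr// lte_fin.
    by exists k => q pq i ki; exact: kP.
  exists k => // i ki; apply: esup0_le; first by rewrite adde_ge0// lee_fin ltW.
  by move=> _ [q Nq <-]; exact: kP.
split=> [|Vcont eps eps0].
  (* [V] is locally bounded since it lies below [L_i], which is so for large [i]. *)
  have [k kP] : exists k, forall q, N q -> V q <= k%:R%:E.
    apply: compact_uniform => // [k l q kl /le_trans|p Np].
      by apply; rewrite lee_fin ler_nat.
    have [n Vn] : exists n, V p < n%:R%:E.
      rewrite -(fineK (Vfin p Np)); have := archi_boundP (fine_ge0 (V0 p)).
      by move=> Vn; exists (Num.bound (fine (V p))); rewrite lte_fin.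
    have [k kP] := near_ub _ _ Vn.
    exists (maxn n k) => q pq; apply: (le_trans (VL k q)).
    apply: (@le_trans _ _ n%:R%:E); last by rewrite lee_fin ler_nat leq_maxl.
    by apply: kP => //; rewrite (lt_le_trans pq)// ler_scale// leq_maxr.
  apply: le_lt_trans (ltry k%:R); apply: esup0_le => // _ [q Nq <-].
  exact: kP.
have [k kP] : exists k, forall q, N q -> N q -> forall i, (k <= i)%N ->
    L i q <= V q + eps%:E.
  apply: compact_uniform => // [k l q kl kP Nq i li|p Np].
    by apply: kP => //; exact: leq_trans li.
  have e2 : (0 < eps / 2)%R by rewrite divr_gt0.
  have [|k1 k1P] := near_ub p (V p + (eps / 2)%:E).
    by rewrite lteDl ?Vfin// lte_fin.
  have [k2 k2P] : exists k, forall q, (mdist p q < scale k)%R ->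
      N q -> V p - (eps / 2)%:E < V q.
    have lt_Vp : V p - (eps / 2)%:E < V p.
      by rewrite lteBlDr// lteDl ?Vfin// lte_fin.
    apply: near_scale; move/subspace_continuousP: Vcont => /(_ p Np) Vp.
    exact: Vp (open_ereal_gt' lt_Vp).
  exists (maxn k1 k2) => q pq Nq i ki.
  apply: (@le_trans _ _ (V p + (eps / 2)%:E)).
    apply: k1P; first exact: leq_trans (leq_maxl _ _) ki.
    by rewrite (lt_le_trans pq)// ler_scale// leq_maxl.
  have : V p - (eps / 2)%:E < V q.
    by apply: k2P => //; rewrite (lt_le_trans pq)// ler_scale// leq_maxr.
  rewrite -(fineK (Vfin p Np)) -(fineK (Vfin q Nq)) -EFinB -!EFinD.
  by rewrite lte_fin lee_fin; lra.
exists k => // i ki p Np.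
have LV0 : 0 <= L i p - V p by rewrite sube_ge0 ?Vfin// VL.
by rewrite gee0_abs// leeBlDl ?Vfin//; exact: kP.
Unshelve. all: by end_near.
Qed.
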